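(* Let $a\le x<x'\le b$ be real numbers, $0<\alpha\le\frac12$, $y=(1-\alpha)x+\alpha x'$, $y'=\alpha x+(1-\alpha)x'$. Let $f:[a,b]\to\mathbb{R}$ be convex and let $p:[x,x']\to[0,\infty)$ be integrable and symmetric about $\frac{x+x'}{2}$. Let $\mathrm{Ip}_1,\mathrm{Jp}:[0,1]\to\mathbb{R}$ be the functions defined in the context. Then $\mathrm{Ip}_1(t)\le \mathrm{Jp}(t)$ for all $t\in[0,1]$.
   Context: Symmetric about $\frac{x+x'}{2}$ means $p(s)=p(x+x'-s)$ for $s\in[x,x']$. For $t\in[0,1]$ define $$\mathrm{Ip}_1(t)=\int_x^{x'}\left[f\big(t((1-\alpha)x+\alpha s)+(1-t)y\big)+f\big(t((1-\alpha)x'+\alpha s)+(1-t)y'\big)\right]p(s)\,ds,$$ $$\mathrm{Jp}(t)=\int_x^{x'}\left[f\left(t((1-\alpha)x+\alpha s)+(1-t)\frac{x+y}{2}\right)+f\left(t((1-\alpha)x'+\alpha s)+(1-t)\frac{x'+y'}{2}\right)\right]p(s)\,ds.$$ *)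

(* Defs.v *)
From mathcomp Require Import all_boot all_order all_algebra.
From mathcomp Require Import all_classical all_reals all_analysis.

Set Implicit Arguments.
Unset Strict Implicit.
Unset Printing Implicit Defensive.

Import Order.TTheory GRing.Theory Num.Theory.
Import numFieldNormedType.Exports.

Local Open Scope classical_set_scope.
Local Open Scope ring_scope.

(* Integrals are taken with respect to the completed Lebesgue measure rather
   than [lebesgue_measure], whose sigma-algebra is the Borel one: a Lebesgue (or
   Riemann) integrable weight need not be Borel measurable. *)
Notation leb R := (@completed_lebesgue_measure R).

Definition Ip1 (R : realType) (f p : R -> R) (x x' y y' alpha t : R) : R :=
  \int[leb R]_(s in `[x, x'])
    ((f (t * ((1 - alpha) * x + alpha * s) + (1 - t) * y)
      + f (t * ((1 - alpha) * x' + alpha * s) + (1 - t) * y')) * p s).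

Definition Jp (R : realType) (f p : R -> R) (x x' y y' alpha t : R) : R :=
  \int[leb R]_(s in `[x, x'])
    ((f (t * ((1 - alpha) * x + alpha * s) + (1 - t) * ((x + y) / 2))
      + f (t * ((1 - alpha) * x' + alpha * s) + (1 - t) * ((x' + y') / 2)))
     * p s).

Definition symmetric_on (R : realType) (p : R -> R) (x x' : R) : Prop :=
  {in `[x, x'], forall s, p s = p (x + x' - s)}.

(* Main.v *)
(** By symmetry of [p], the integral of [f (m * s + q) * p s] is unchanged when
    the affine argument is replaced by its value at the reflected point
    [x + x' - s].  Reflecting the first summand of both integrands makes the
    inequality pointwise: the two arguments of [f] in [Ip1] and the two in [Jp]
    then have the same midpoint, and the former lie between the latter, so that
    convexity of [f] applies. *)
Require Import Defs.
From mathcomp Require Import all_boot all_order all_algebra.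
From mathcomp Require Import all_classical all_reals all_analysis.
From mathcomp Require Import measurable_realfun ring lra.

Import Order.TTheory GRing.Theory Num.Theory.
Import numFieldNormedType.Exports.

Local Open Scope classical_set_scope.
Local Open Scope ring_scope.

(** * Invariance of completed Lebesgue measure and its integral under reflection *)

Section Reflection.
Context {R : realType}.
Local Open Scope ereal_scope.
Notation outer := (@mu_ext _ (ocitv_type R) R (wlength idfun)).

(* [leb R] is [outer] restricted to its Caratheodory-measurable sets, so that
   its reflection invariance reduces to that of [outer]. *)
Lemma outer_reflection_le (c : R) (A : set R) :
  outer ((fun s => c - s)%R @^-1` A) <= outer A.
Proof.
apply: le_ereal_inf_tmp => _ [F [mF AF] <-].
apply: (@le_trans _ _
  (\sum_(0 <= k <oo) outer ((fun s => c - s)%R @^-1` (F k)))).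
  apply: le_trans (outer_measure_sigma_subadditive _ _).
  apply: le_outer_measure => s /AF [k _ Fk]; by exists k.
apply: lee_nneseries => [k _ _|k _].
  exact: outer_measure_ge0.
have [[u v] _ <-] := mF k.
have -> : (fun s => c - s)%R @^-1` `]u, v]%classic =
    `[(c - v)%R, (c - u)%R[%classic.
  by apply/seteqP; split => s /=; rewrite !in_itv/= => /andP[? ?];
    apply/andP; split; lra.
(* The reflected interval is closed on the left and open on the right, so [wlength] does not give
   its outer measure directly; the Lebesgue measure, a restriction of [outer], does. *)
have := @lebesgue_measure_itv R `[(c - v)%R, (c - u)%R[.
rewrite [X in X = _ -> _](_ : _ = outer `[(c - v)%R, (c - u)%R[%classic)//.
move=> ->.
rewrite wlength_itv/= !lte_fin -!EFinB.
have -> : (c - v < c - u)%R = (u < v)%R by apply/idP/idP; lra.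
by case: ifP => // _; rewrite lee_fin; lra.
Qed.

Lemma reflectionK (c : R) (A : set R) :
  (fun s => c - s)%R @^-1` ((fun s => c - s)%R @^-1` A) = A.
Proof. by apply/seteqP; split => s /=; rewrite opprB addrCA subrr addr0. Qed.

(** Reflection is an involution, so the one-sided bound applied to the reflected set gives the
    converse. *)
Lemma outer_reflection (c : R) (A : set R) :
  outer ((fun s => c - s)%R @^-1` A) = outer A.
Proof.
apply/eqP; rewrite eq_le outer_reflection_le /=.
by rewrite -{1}(reflectionK c A) outer_reflection_le.
Qed.

Notation L := (caratheodory_type outer).

(** The Caratheodory criterion for the preimage of [A] at a test set [X] is the criterion for [A] at
    the reflected [X]. *)
Lemma measurable_reflection (c : R) :
  measurable_fun [set: L] ((fun s => c - s)%R : L -> L).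
Proof.
move=> _ A mA; rewrite setTI.
have {}mA : caratheodory_measurable outer A by exact: mA.
suff : caratheodory_measurable outer ((fun s => c - s)%R @^-1` A) by [].
move=> X; rewrite -(outer_reflection c) mA -(outer_reflection c (_ `&` A)).
rewrite -(outer_reflection c (_ `&` ~` A)) 2!preimage_setI preimage_setC.
by rewrite reflectionK.
Qed.

Lemma integral_reflection (c : R) (D : set R) (g : R -> \bar R) :
  @measurable _ L D -> measurable_fun (D : set L) g ->
  \int[leb R]_(s in D) g s =
  \int[leb R]_(s in (fun s => c - s)%R @^-1` D) g (c - s)%R.
Proof.
move=> mD mg.
have ge0 (h : R -> \bar R) :
    measurable_fun (D : set L) h -> (forall s, 0 <= h s) ->
    \int[leb R]_(s in D) h s =
    \int[leb R]_(s in (fun s => c - s)%R @^-1` D) h (c - s)%R.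
  move=> mh h0.
  have mphi := measurable_reflection c.
  (* The right side is an integral over [D] against the pushforward measure, which reflection
     invariance identifies with [leb R]. *)
  rewrite -(ge0_integral_pushforward mphi _ mD)//.
  apply: eq_measure_integral => A _ _.
  exact/esym/outer_reflection.
rewrite integralE [RHS]integralE; congr (_ - _).
  rewrite ge0//; last exact: measurable_funepos.
  by apply: eq_integral => s _; rewrite (funepos_comp g (fun s => c - s)%R).
rewrite ge0//; last exact: measurable_funeneg.
by apply: eq_integral => s _; rewrite (funeneg_comp g (fun s => c - s)%R).
Qed.

Lemma measurable_fun_leb (D : set R) (g : R -> R) :
  @measurable _ (measurableTypeR R) D ->
  measurable_fun (D : set (measurableTypeR R)) g ->
  measurable_fun (D : set L) g.
Proof. by move=> mD mg _ Y mY; apply: sub_caratheodory; apply: mg. Qed.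

Lemma measurable_itv_leb (u v : R) : @measurable _ L `[u, v]%classic.
Proof. by apply: sub_caratheodory; exact: measurable_itv. Qed.

End Reflection.

(** * Convex functions on a segment: inequalities, boundedness, integrability *)

Section Convex.
Context {R : realType}.
Variables (a b : R) (f : R -> R).
Hypothesis hf : convex_function (`[a, b]%classic : set R^o) f.

Lemma convex_itv_le (u v k : R) : a <= u <= b -> a <= v <= b -> 0 <= k <= 1 ->
  f (k * u + (1 - k) * v) <= k * f u + (1 - k) * f v.
Proof.
move=> hu hv k01.
have := hf (Itv01 (andP k01).1 (andP k01).2) u v.
rewrite !inE /= !in_itv/= => /(_ hu hv).
by rewrite !convRE.
Qed.

Lemma itv_convex_combination (u v z : R) : u <= z <= v ->
  exists2 k, 0 <= k <= 1 & z = k * u + (1 - k) * v.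
Proof.
move=> /andP[uz zv]; have [uv|uv] := eqVneq u v.
  by exists 0; lra.
have uv0 : 0 < v - u by lra.
exists ((v - z) / (v - u)); last by field; lra.
by rewrite divr_ge0 ?ler_pdivrMr//=; lra.
Qed.

(** If [z] has weights [k] and [1 - k], equality of sums gives [w] the swapped weights; the two
    convexity inequalities then add up. *)
Lemma convex_itv_pair_le (u v z w : R) : a <= u -> v <= b -> u <= z <= v ->
  z + w = u + v -> f z + f w <= f u + f v.
Proof.
move=> au vb uzv zw; have [k k01 hz] := itv_convex_combination _ _ _ uzv.
have uab : a <= u <= b by lra.
have vab : a <= v <= b by lra.
have k01' : 0 <= 1 - k <= 1 by lra.
have hw : w = (1 - k) * u + (1 - (1 - k)) * v by lra.
have := convex_itv_le _ _ _ uab vab k01.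
have := convex_itv_le _ _ _ uab vab k01'.
by rewrite -hz -hw; lra.
Qed.

Lemma convex_itv_le_max (u v z : R) : a <= u -> v <= b -> u <= z <= v ->
  f z <= Num.max (f u) (f v).
Proof.
move=> au vb uzv; have [k k01 hz] := itv_convex_combination _ _ _ uzv.
have uab : a <= u <= b by lra.
have vab : a <= v <= b by lra.
have := convex_itv_le _ _ _ uab vab k01; rewrite -hz => /le_trans; apply.
have : f u <= Num.max (f u) (f v) by rewrite le_max lexx.
have : f v <= Num.max (f u) (f v) by rewrite le_max lexx orbT.
nra.
Qed.

Lemma convex_itv_bounded : exists M, forall z, a <= z <= b -> `|f z| <= M.
Proof.
(* [m] bounds [f] from above. The midpoint of [z] and [a + b - z] is that of [a] and [b], so
   [2 * c <= f z + f (a + b - z) <= f z + m], whence [2 * c - m] bounds [f] from below. *)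
pose m := Num.max (f a) (f b); pose c := f (2^-1 * a + (1 - 2^-1) * b).
exists (`|m| + `|2 * c - m|) => z /andP[az zb].
have h1 : f z <= m by apply: convex_itv_le_max => //; lra.
have h2 : f (a + b - z) <= m by apply: convex_itv_le_max => //; lra.
have h3 : c <= 2^-1 * f z + (1 - 2^-1) * f (a + b - z).
  rewrite (_ : c = f (2^-1 * z + (1 - 2^-1) * (a + b - z))).
    by rewrite convex_itv_le; lra.
  by rewrite /c; congr f; lra.
have := ler_norm m; have := ler_norm (- (2 * c - m)); rewrite normrN.
have := normr_ge0 (2 * c - m); have := normr_ge0 m.
by rewrite ler_norml; lra.
Qed.

(** Continuity may fail at the endpoints, so the proof uses quasi-convexity: strict sublevel sets
    are intervals, and preimages of closed upper rays are their complements in the segment. *)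
Lemma convex_itv_measurable :
  measurable_fun (`[a, b] : set (measurableTypeR R)) f.
Proof.
move=> mD; apply: (measurability _ (RGenCInfty.measurableE R)) => //.
move=> _ [_ [r ->] <-].
rewrite (_ : _ `&` _ = `[a, b] `\` [set z | a <= z <= b /\ f z < r]).
  apply: measurableD => //; apply: is_interval_measurable.
  move=> u v [/andP[au ub] fu] [/andP[av vb] fv] z /andP[uz zv].
  split; first lra.
  by apply: (le_lt_trans (convex_itv_le_max _ _ _ au vb _));
    rewrite ?gt_max ?fu ?fv// uz.
apply/seteqP; split => z /=; rewrite !in_itv/= andbT => -[zab].
  by move=> rf; split=> // -[_]; rewrite ltNge rf.
by move=> nf; split=> //; rewrite leNgt; apply/negP => ?; apply: nf.
Qed.

Lemma convex_affine_integrable (x x' m q : R) (p : R -> R) :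
  (forall s, x <= s <= x' -> a <= m * s + q <= b) ->
  (leb R).-integrable `[x, x'] (fun s => (p s)%:E) ->
  (leb R).-integrable `[x, x'] (EFin \o (fun s => f (m * s + q) * p s)).
Proof.
move=> mab hp.
rewrite (_ : EFin \o _ =
  (EFin \o (fun s => f (m * s + q))) \* (fun s => (p s)%:E))%E //.
apply: integrableMr => //.
- exact: measurable_itv_leb.
- apply: measurable_fun_leb => //.
  apply: (@measurable_comp _ _ _ _ _ _ `[a, b]%classic f) => //.
  + by move=> _ [s /= + <-]; rewrite !in_itv/= => /mab.
  + exact: convex_itv_measurable.
  + exact/measurable_funTS/measurable_funD/measurable_cst/measurable_funM.
- have [M hM] := convex_itv_bounded.
  exists M; split; first exact: num_real.
  move=> N MN s /=; rewrite in_itv/= => /mab/hM/le_trans; apply; exact: ltW.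
Qed.

Lemma convex_affine_sum_integrable (x x' m q m' q' : R) (p : R -> R) :
  (forall s, x <= s <= x' -> a <= m * s + q <= b) ->
  (forall s, x <= s <= x' -> a <= m' * s + q' <= b) ->
  (leb R).-integrable `[x, x'] (fun s => (p s)%:E) ->
  (leb R).-integrable `[x, x']
    (EFin \o (fun s => (f (m * s + q) + f (m' * s + q')) * p s)).
Proof.
move=> hq hq' hp.
have i := convex_affine_integrable _ _ _ _ _ hq hp.
have i' := convex_affine_integrable _ _ _ _ _ hq' hp.
have := integrableD (measurable_itv_leb x x') i i'.
congr integrable; apply/funext => s /=.
by rewrite -EFinD mulrDl.
Qed.

(** Only the first summand is reflected, which requires splitting the integral; the new affine map
    is [m * (x + x' - s) + q] expanded. *)
Lemma Rintegral_convex_reflection (x x' m q q' : R) (p : R -> R) :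
  (forall s, x <= s <= x' -> a <= m * s + q <= b) ->
  (forall s, x <= s <= x' -> a <= m * s + q' <= b) ->
  (leb R).-integrable `[x, x'] (fun s => (p s)%:E) ->
  symmetric_on p x x' ->
  \int[leb R]_(s in `[x, x']) ((f (m * s + q) + f (m * s + q')) * p s) =
  \int[leb R]_(s in `[x, x'])
    ((f (- m * s + (m * (x + x') + q)) + f (m * s + q')) * p s).
Proof.
move=> hq hq' hp psym.
have mD := measurable_itv_leb x x'.
have hqr s : x <= s <= x' -> a <= - m * s + (m * (x + x') + q) <= b.
  by move=> xs; have := hq (x + x' - s); lra.
have iq := convex_affine_integrable _ _ _ _ _ hq hp.
have iq' := convex_affine_integrable _ _ _ _ _ hq' hp.
have iqr := convex_affine_integrable _ _ _ _ _ hqr hp.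
under eq_Rintegral do rewrite mulrDl.
under [RHS]eq_Rintegral do rewrite mulrDl.
rewrite !RintegralD//; congr (_ + _).
rewrite /Rintegral; congr fine.
rewrite (integral_reflection (x + x')) //; last first.
  exact: (measurable_int (leb R) iq).
rewrite (_ : _ @^-1` _ = `[x, x']%classic); last first.
  by apply/seteqP; split => s /=; rewrite !in_itv/=; lra.
apply: eq_integral => s; rewrite inE /= => xs.
by rewrite -(psym s xs); congr (f _ * _)%:E; lra.
Qed.

End Convex.

Theorem theorem11 (R : realType) (a b x x' alpha y y' : R) (f p : R -> R)
    (hax : a <= x) (hxx' : x < x') (hx'b : x' <= b)
    (halpha0 : 0 < alpha) (halpha1 : alpha <= 1 / 2)
    (hy : y = (1 - alpha) * x + alpha * x')
    (hy' : y' = alpha * x + (1 - alpha) * x')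
    (hf : convex_function (`[a, b]%classic : set R^o) f)
    (hp0 : {in `[x, x'], forall s, 0 <= p s})
    (hpint : (leb R).-integrable `[x, x'] (fun s => (p s)%:E))
    (hpsym : symmetric_on p x x') :
  forall t : R, t \in `[0, 1] ->
    Ip1 f p x x' y y' alpha t <= Jp f p x x' y y' alpha t.
Proof.
move=> t; rewrite in_itv/= => t01.
(* These products carry all the nonlinear information: the later bounds are linear combinations of
   them. *)
have P0 : 0 <= (1 - t) * alpha * (x' - x) by rewrite !mulr_ge0; lra.
have P1 : 0 <= (1 - 2 * alpha) * (x' - x) by rewrite !mulr_ge0; lra.
have P2 s : x <= s <= x' -> 0 <= t * alpha * (s - x).
  by move=> ?; rewrite !mulr_ge0; lra.
have P3 s : x <= s <= x' -> 0 <= t * alpha * (x' - s).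
  by move=> ?; rewrite !mulr_ge0; lra.
(* All four arguments of [f] are affine in [s] with slope [t * alpha]; these are their
   intercepts. *)
pose qA := t * ((1 - alpha) * x) + (1 - t) * y.
pose qB := t * ((1 - alpha) * x') + (1 - t) * y'.
pose qC := t * ((1 - alpha) * x) + (1 - t) * ((x + y) / 2).
pose qD := t * ((1 - alpha) * x') + (1 - t) * ((x' + y') / 2).
have -> : Ip1 f p x x' y y' alpha t = \int[leb R]_(s in `[x, x'])
    ((f (t * alpha * s + qA) + f (t * alpha * s + qB)) * p s).
  by apply: eq_Rintegral => s _; congr ((f _ + f _) * _); rewrite /qA /qB; lra.
have -> : Jp f p x x' y y' alpha t = \int[leb R]_(s in `[x, x'])
    ((f (t * alpha * s + qC) + f (t * alpha * s + qD)) * p s).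
  by apply: eq_Rintegral => s _; congr ((f _ + f _) * _); rewrite /qC /qD; lra.
have hA s : x <= s <= x' -> a <= t * alpha * s + qA <= b.
  by move=> xs; have := P2 s xs; have := P3 s xs; rewrite /qA hy; lra.
have hB s : x <= s <= x' -> a <= t * alpha * s + qB <= b.
  by move=> xs; have := P2 s xs; have := P3 s xs; rewrite /qB hy'; lra.
have hC s : x <= s <= x' -> a <= t * alpha * s + qC <= b.
  by move=> xs; have := P2 s xs; have := P3 s xs; rewrite /qC hy; lra.
have hD s : x <= s <= x' -> a <= t * alpha * s + qD <= b.
  by move=> xs; have := P2 s xs; have := P3 s xs; rewrite /qD hy'; lra.
rewrite !(Rintegral_convex_reflection _ _ _ hf)//.
have hR q s : (forall s, x <= s <= x' -> a <= t * alpha * s + q <= b) ->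
    x <= s <= x' -> a <= - (t * alpha) * s + (t * alpha * (x + x') + q) <= b.
  by move=> hq xs; have := hq (x + x' - s); lra.
apply: le_Rintegral.
- exact: measurable_itv_leb.
- by apply: (convex_affine_sum_integrable _ _ _ hf) => // s; exact: hR.
- by apply: (convex_affine_sum_integrable _ _ _ hf) => // s; exact: hR.
move=> s sx; apply: ler_wpM2r; first exact: hp0.
move: sx; rewrite /= in_itv/= => xs.
have xrs : x <= x + x' - s <= x' by lra.
have Cs := hC _ xrs; have Ds := hD _ xs.
have P2s := P2 s xs; have P3s := P3 s xs.
(* On each side the two arguments add up to [x + x']. The reflected [qA] argument exceeds the
   reflected [qC] one by half of the product in [P0]; it stays below the [qD] one thanks to [P1],
   that is, to [alpha <= 1 / 2]. *)
apply: (convex_itv_pair_le _ _ _ hf); move: Cs Ds;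
  rewrite /qA /qB /qC /qD hy hy'; lra.
Qed.
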